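(* Let $d\ge 1$ and $k\ge 1$ be integers, let $a>0$, and let $V:\mathbb{R}^d\to\mathbb{R}$ be given by $V(x)=a|x|^{2k}+e^{-1/|x|}$ for $x\neq 0$ and $V(0)=0$. Then for every $h>1$ the system $$\ddot q+V'(q)=0,\qquad \tfrac12|\dot q|^2+V(q)=h$$ has at least one non-constant periodic solution, i.e. there exist $T>0$ and a non-constant $T$-periodic function $q\in C^2(\mathbb{R},\mathbb{R}^d)$ satisfying both equations for all $t\in\mathbb{R}$.
   Context: $V'(q)$ denotes the gradient of $V$ at $q$ and $|\cdot|$ the Euclidean norm on $\mathbb{R}^d$. Dots over $q$ denote derivatives with respect to $t$. *)

(* Defs.v *)
From mathcomp Require Import all_boot all_order all_algebra.
From mathcomp Require Import all_classical all_reals all_analysis.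
Set Implicit Arguments.
Unset Strict Implicit.
Unset Printing Implicit Defensive.
Import Order.TTheory GRing.Theory Num.Theory.
Import numFieldNormedType.Exports.

Local Open Scope ring_scope.
Local Open Scope classical_set_scope.

(* The canonical norm on 'rV[R]_d is the sup norm, hence this definition.
   The two norms induce the same topology, so derivatives are unaffected. *)
Definition enorm (R : realType) (d : nat) (x : 'rV[R]_d) : R :=
  Num.sqrt (\sum_(i < d) x 0 i ^+ 2).

(* Partial derivatives are total ('D_v returns an arbitrary value when the
   limit does not exist); the potential below is C^1 on the whole space when
   0 < k, including at the origin, so no such value occurs there. *)
Definition gradient (R : realType) (d : nat) (f : 'rV[R]_d -> R)
    (x : 'rV[R]_d) : 'rV[R]_d :=
  \row_(i < d) 'D_(delta_mx 0 i) f x.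

Definition potential (R : realType) (d k : nat) (a : R) (x : 'rV[R]_d) : R :=
  if x == 0 then 0
  else a * enorm x ^+ (2 * k) + expR (- (1 / enorm x)).

Definition C2 (R : realType) (d : nat) (q : R -> 'rV[R]_d) : Prop :=
  [/\ forall t, derivable q t 1,
      forall t, derivable q^`() t 1
    & continuous q^`(2)].

(* Main.v *)
(* The motion is rectilinear: q(t) = x(t) e for a fixed unit vector e.  Writing
   the potential as F(|q|^2) with F of class C^1 on R and increasing on
   [0, +oo[, choose r > 0 with F(r^2) = h and let
   S(u) = (F(u) - F(r^2)) / (u - r^2), extended by S(r^2) = F'(r^2): it is
   continuous, and positive on [0, r^2].  The substitution x = r sin(th) turns
   the energy equation into th' = sqrt (2 S(r^2 sin(th)^2)), which has no
   turning point: its right-hand side is continuous, positive and 2 pi-periodic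
   in th, so th is the inverse of an antiderivative, and x is periodic.  Away
   from the turning points, x'' = - 2 x F'(x^2) follows by differentiating the
   energy; at them, x' = r cos(th) th' is the product of a differentiable
   function vanishing there and of a continuous one. *)
Require Import Defs.
From mathcomp Require Import all_boot all_order all_algebra.
From mathcomp Require Import all_classical all_reals all_analysis.
From mathcomp Require Import ring lra.
Import Order.TTheory GRing.Theory Num.Theory.
Import numFieldNormedType.Exports.

Local Open Scope ring_scope.
Local Open Scope classical_set_scope.

Set Implicit Arguments.
Unset Strict Implicit.
Unset Printing Implicit Defensive.

(** * Antiderivatives and scalar autonomous equations *)

Lemma is_derive_continuous (R : realType) (V : normedModType R) (f : R -> V)
    (x : R) (l : V) : is_derive x 1 f l -> {for x, continuous f}.
Proof.
by move=> fl; apply/differentiable_continuous/derivable1_diffP/ex_derive.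
Qed.

(** An integral from a fixed base point is an antiderivative only to the right of that point, so
    integrals from [- N] for different [N] are glued. *)
Lemma continuous_antiderivative (R : realType) (c : R -> R) :
  continuous c -> exists A : R -> R, forall x : R, is_derive x 1 A (c x).
Proof.
move=> cc; pose mu := @lebesgue_measure R.
have ic (a b : R) : mu.-integrable `[a, b] (EFin \o c).
  apply: continuous_compact_integrable; first exact: segment_compact.
  exact: continuous_subspaceT.
(* Subtracting the integral up to 0 normalises [B N 0 = 0], so that the value at [x] no longer
   depends on the base point [- N]. *)
pose B (N x : R) : R :=
  \int[mu]_(t in `[- N, x]) c t - \int[mu]_(t in `[- N, 0]) c t.
have split_at (M N x : R) : N <= M -> - N <= x ->
    \int[mu]_(t in `[- M, x]) c t =
    \int[mu]_(t in `[- M, - N]) c t + \int[mu]_(t in `[- N, x]) c t.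
  move=> NM Nx; apply/eqP; rewrite addrC -subr_eq; apply/eqP.
  rewrite Rintegral_itvB ?bnd_simp ?lerN2//.
  rewrite Rintegral_itv_obnd_cbnd//; apply: integrableS (ic (- N) x) => //.
  exact: subset_itv_oc_cc.
have B_le (M N x : R) : 0 <= N -> N <= M -> - N <= x -> B M x = B N x.
  move=> N0 NM Nx; rewrite /B (split_at _ _ _ NM Nx) (split_at _ _ 0 NM).
    ring.
  by rewrite oppr_le0.
exists (fun x => B (`|x| + 1) x) => x.
pose N : R := `|x| + 2.
have xN : - N < x by move: (ler_norm (- x)); rewrite normrN /N; lra.
have x1 : x < x + 1 by rewrite ltrDl.
have [dB BE] := continuous_FTC1_closed x1 (ic (- N) _) xN (cc x).
apply: (@near_eq_is_derive _ _ _ (B N)).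
  near=> y.
  have : `|y - x| < 1.
    by rewrite distrC; near: y; exact: (@cvgr_dist_lt _ _ _ _ _ (fun y=>y)).
  move=> yx; have yN : `|y| + 1 <= N.
    rewrite /N; have := ler_normD (y - x) x; rewrite subrK; lra.
  apply: B_le => //.
  have := ler_norm (- y); rewrite normrN; lra.
have dI : is_derive x 1 (fun y => \int[mu]_(t in `[- N, y]) c t) (c x).
  by constructor; [exact: dB | rewrite -derive1E; exact: BE].
have := is_deriveB dI (is_derive_cst (\int[mu]_(t in `[- N, 0]) c t) x 1).
by rewrite subr0.
Unshelve. all: by end_near. Qed.

(** Separation of variables: [th] is the inverse of an antiderivative [A] of [1 / g]. Since
    [1 / g >= 1 / M], [A] grows at least linearly, hence is a bijection of the line, and [T] is its
    increment over one period of [g]. *)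
Lemma scalar_ode (R : realType) (g : R -> R) (M p : R) :
  continuous g -> (forall x, 0 < g x) -> (forall x, g x <= M) -> 0 < p ->
  periodic g p ->
  exists (th : R -> R) (T : R), [/\ 0 < T,
    forall t : R, is_derive t 1 th (g (th t)),
    forall t, th (t + T) = th t + p & forall y, exists t, th t = y].
Proof.
move=> cg g0 gM p0 gp.
have M0 : 0 < M := lt_le_trans (g0 0) (gM 0).
have [A dA] : exists A : R -> R, forall x : R, is_derive x 1 A ((g x)^-1).
  apply: continuous_antiderivative => x; apply: continuousV => //;
    last exact: cg.
  by rewrite gt_eqF.
have cA : continuous A by move=> x; exact: is_derive_continuous (dA x).
have A_ge (x y : R) : x <= y -> M^-1 * (y - x) <= A y - A x.
  move=> xy; have [|c _ ->] := MVT_segment xy (fun z _ => dA z).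
    exact: continuous_subspaceT.
  by rewrite ler_wpM2r ?subr_ge0// lef_pV2// posrE.
have A_surj y : exists t, A t = y.
  (* With slope at least [M^-1], [A] moves by at least [|y - A 0| + 1] between 0 and [r] and between
     [- r] and 0, so it takes the value [y] in between. *)
  pose r := M * (`|y - A 0| + 1).
  have r0 : 0 <= r by rewrite mulr_ge0 ?ltW// addr_gt0.
  have Mr : M^-1 * r = `|y - A 0| + 1 by rewrite /r mulKf// gt_eqF.
  have lo := A_ge (- r) 0; have hi := A_ge 0 r.
  rewrite sub0r opprK Mr oppr_le0 in lo; rewrite subr0 Mr in hi.
  have {lo} lo := lo r0; have {hi} hi := hi r0.
  have n1 := ler_norm (y - A 0); have n2 := ler_norm (- (y - A 0)).
  rewrite normrN in n2.
  have [|||t _ <-] := @IVT _ A (- r) r y;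
    [lra|exact: continuous_subspaceT| |by exists t].
  by rewrite ge_min le_max; apply/andP; split; apply/orP; [left|right]; lra.
have A_inj : injective A.
  move=> x y Axy; wlog xy : x y Axy / x <= y.
    by move=> H; case: (leP x y) => [/H->//|/ltW /H ->].
  have := A_ge _ _ xy; rewrite Axy subrr pmulr_rle0 ?invr_gt0// subr_le0 => yx.
  by apply/eqP; rewrite eq_le xy.
pose th y := sval (cid (A_surj y)).
have thK : cancel th A by move=> y; rewrite /th; case: cid.
have AK : cancel A th by move=> x; apply: A_inj; rewrite thK.
exists th, (A p - A 0); split.
- have := A_ge 0 p (ltW p0); rewrite subr0; apply: lt_le_trans.
  by rewrite mulr_gt0 ?invr_gt0.
- move=> t; rewrite -[in is_derive _]/(thK t) -{1}(thK t) -[g _]invrK.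
  apply: is_derive_inverse => //.
  + rewrite /prop_near1 /=. apply: filterE => z; exact: AK.
  + apply: filterE => z; exact: cA.
  + by rewrite invr_eq0 gt_eqF.
(* Periodicity of [g] makes [A (y + p) - A y] constant, equal to [A p - A 0 = T]. *)
- have dAp (x : R) : is_derive x 1 (fun y => A (y + p) - A y) 0.
    rewrite -(subrr (g x)^-1); apply: is_deriveB.
    rewrite -{1}gp -[X in is_derive _ _ _ X]mulr1.
    apply: (@is_derive1_comp _ A (fun y => y + p)).
    by rewrite -[X in is_derive _ _ _ X]addr0; exact: is_deriveD.
  move=> t; apply: A_inj; rewrite thK.
  have /eqP := @is_derive_0_is_cst _ _ (th t) 0 dAp; rewrite /= add0r thK.
  by rewrite subr_eq => /eqP ->; rewrite [LHS]addrC.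
- by move=> y; exists (A y).
Qed.

(** * One-dimensional oscillations *)

(** The factorisation of [v z ^+ 2 - v t ^+ 2] recovers the slope of [v], because [v z + v t] stays
    nonzero near [t]. It serves away from the turning points. *)
Lemma is_derive_of_sqr (R : realType) (v : R -> R) (t D : R) :
  {for t, continuous v} -> v t != 0 -> is_derive t 1 (fun s => v s ^+ 2) D ->
  is_derive t 1 v (D / (2 * v t)).
Proof.
move=> cv v0 /is_derive1_caratheodory[h [hE hc hD]].
have vt0 : v t + v t != 0 by rewrite -mulr2n mulrn_eq0.
apply/is_derive1_caratheodory.
(* Where [v z + v t] vanishes, which cannot happen near [t], the plain difference quotient serves as
   slope. *)
exists (fun z => if v z + v t == 0 then (v z - v t) / (z - t)
                 else h z / (v z + v t)); split.
- move=> z; case: eqP => [vz|/eqP vz].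
    rewrite divfK// subr_eq0; apply: contraNneq vt0 => zt.
    by rewrite -{1}zt vz.
  by apply: (mulIf vz); rewrite mulrAC divfK// -hE; ring.
- have c1 : {for t, continuous (fun z => h z / (v z + v t))}.
    apply: continuousM => //; apply: continuousV => //.
    by apply: continuousD => //; exact: cst_continuous.
  rewrite /prop_for /continuous_at /= ifN//.
  apply: cvg_trans c1; apply: near_eq_cvg.
  have cs : {for t, continuous (fun z => v z + v t)}.
    by apply: continuousD => //; exact: cst_continuous.
  near=> z; rewrite ifN//.
  near: z; exact: (cvgr_neq0 _ cs vt0).
- by rewrite /= ifN// hD mulr_natl mulr2n.
Unshelve. all: by end_near. Qed.

(** Because [c t = 0], the slope of the product at [t] is the slope of [c] times [g], whose limit
    asks only for continuity of [g]. It serves at the turning points. *)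
Lemma is_derive_zeroM (R : realType) (c g : R -> R) (t c' : R) :
  c t = 0 -> is_derive t 1 c c' -> {for t, continuous g} ->
  is_derive t 1 (fun s => c s * g s) (c' * g t).
Proof.
move=> c0 /is_derive1_caratheodory[h [hE hc <-]] cg.
apply/is_derive1_caratheodory; exists (fun z => h z * g z); split => //.
- by move=> z; rewrite mulrAC -hE c0 subr0 mul0r subr0.
- exact: continuousM.
Qed.

Lemma oscillation (R : realType) (F f : R -> R) (r : R) :
  (forall u : R, is_derive u 1 F (f u)) -> 0 < r -> 0 < f (r ^+ 2) ->
  (forall u, 0 <= u -> u < r ^+ 2 -> F u < F (r ^+ 2)) ->
  exists (x v : R -> R) (T : R),
    [/\ 0 < T, periodic x T & exists s t, x s = 0 /\ x t = r] /\
    forall t : R, [/\ is_derive t 1 x (v t),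
      is_derive t 1 v (- 2 * f (x t ^+ 2) * x t) &
      1 / 2 * v t ^+ 2 + F (x t ^+ 2) = F (r ^+ 2)].
Proof.
move=> dF r0 fr0 F_lt.
have cF (u : R) : {for u, continuous F} := is_derive_continuous (dF u).
have [S [SE Sc Sr]] := (is_derive1_caratheodory _ _ _).1 (dF (r ^+ 2)).
(* Caratheodory's criterion gives continuity at [r ^+ 2] only; elsewhere [S] is a quotient of
   continuous functions. *)
have {Sc} cS : continuous S.
  move=> u; have [->//|ur] := eqVneq u (r ^+ 2).
  have Suv z : z != r ^+ 2 -> (F z - F (r ^+ 2)) / (z - r ^+ 2) = S z.
    by move=> zr; rewrite SE mulfK// subr_eq0.
  rewrite /continuous_at -(Suv u ur).
  have cu : {for u, continuous (fun z => z - r ^+ 2)}.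
    by apply: continuousB; [exact: cvg_id|exact: cst_continuous].
  have c1 : {for u, continuous (fun z => (F z - F (r ^+ 2)) / (z - r ^+ 2))}.
    apply: continuousM.
      by apply: continuousB => //; exact: cst_continuous.
    by apply: continuousV => //; rewrite subr_eq0.
  apply: cvg_trans c1; apply: near_eq_cvg.
  near=> z; apply/Suv; rewrite -subr_eq0; near: z.
  by apply: (cvgr_neq0 _ cu); rewrite subr_eq0.
have S_gt0 u : 0 <= u <= r ^+ 2 -> 0 < S u.
  case/andP=> u0; rewrite le_eqVlt => /predU1P[->|ur]; first by rewrite Sr.
  have := F_lt _ u0 ur; rewrite -subr_lt0 SE nmulr_llt0// ?subr_lt0//.
(* The maximum of [S] on the compact segment supplies the upper bound on [g] that [scalar_ode]
   requires. *)
have [c cr S_le] : exists2 c, c \in `[0, r ^+ 2]%R &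
    forall u, u \in `[0, r ^+ 2]%R -> S u <= S c.
  by apply: EVT_max; [exact: sqr_ge0|exact: continuous_subspaceT].
pose u (th : R) := (r * sin th) ^+ 2.
have ur th : 0 <= u th <= r ^+ 2.
  rewrite sqr_ge0 /u exprMn ler_piMr ?sqr_ge0// sin2cos2 gerBl sqr_ge0//.
pose g th := Num.sqrt (2 * S (u th)).
have g_gt0 th : 0 < g th by rewrite sqrtr_gt0 mulr_gt0// S_gt0.
have g2 th : g th ^+ 2 = 2 * S (u th).
  by rewrite sqr_sqrtr// mulr_ge0// ltW// S_gt0.
have cg : continuous g.
  move=> th; apply: (@continuous_comp _ _ _ (fun th => 2 * S (u th)) Num.sqrt);
    last exact: sqrt_continuous.
  apply: continuousM; first exact: cst_continuous.
  apply: (@continuous_comp _ _ _ u S); last exact: cS.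
  apply: (@continuous_comp _ _ _ (fun th => r * sin th) (fun y : R => y ^+ 2));
    last exact: exprn_continuous.
  by apply: continuousM; [exact: cst_continuous|exact: continuous_sin].
have g_le th : g th <= Num.sqrt (2 * S c).
  by apply: ler_wsqrtr; rewrite ler_wpM2l// S_le// in_itv/= ur.
have pg : periodic g (pi *+ 2) by move=> th; rewrite /g /u sinD2pi.
have pi2_gt0 : 0 < pi *+ 2 :> R by rewrite pmulrn_lgt0 ?pi_gt0.
have [th [T [T0 dth thT th_surj]]] :=
  scalar_ode cg g_gt0 g_le pi2_gt0 pg.
exists (fun t => r * sin (th t)), (fun t => r * cos (th t) * g (th t)), T.
split.
  split=> //; first by move=> t; rewrite thT sinD2pi.
  (* The phases 0 and [pi / 2] are both attained; there [x] equals 0 and [r]. *)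
  have [s s0] := th_surj 0; have [t tpi] := th_surj (pi / 2).
  by exists s, t; rewrite s0 tpi sin0 sin_pihalf mulr0 mulr1.
move=> t.
pose x t := r * sin (th t); pose v t := r * cos (th t) * g (th t).
have dx s : is_derive (s : R) 1 x (v s).
  by rewrite /x /v -mulrA; apply: is_deriveZ.
(* Here [r ^+ 2 * cos ^+ 2 = r ^+ 2 - x ^+ 2], and its product with [S (x ^+ 2)] is
   [F (r ^+ 2) - F (x ^+ 2)]. *)
have energy s : v s ^+ 2 = 2 * (F (r ^+ 2) - F (x s ^+ 2)).
  rewrite -opprB SE /v exprMn g2 /u -/(x s) exprMn cos2sin2 /x exprMn; ring.
split; [exact: dx| |by rewrite -/(v t) energy -/(x t); field].
rewrite -/(x t) -/v.
have cth : {for t, continuous (fun s => g (th s))}.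
  apply: continuous_comp; [exact: is_derive_continuous (dth t)|exact: cg].
(* At a turning point [v' = - r * sin (th t) * g ^+ 2 = - 2 * x * S (r ^+ 2)], and
   [S (r ^+ 2) = f (r ^+ 2)]. *)
have [c0|c0] := eqVneq (cos (th t)) 0.
  have x2 : x t ^+ 2 = r ^+ 2 by
    rewrite /x exprMn sin2cos2 c0 expr0n/= subr0 mulr1.
  have dc : is_derive t 1 (fun s => r * cos (th s))
      (r * (- sin (th t) * g (th t))).
    by apply: is_deriveZ.
  have := is_derive_zeroM _ dc cth; rewrite c0 mulr0 => /(_ erefl).
  have -> // : r * (- sin (th t) * g (th t)) * g (th t) =
    - 2 * f (x t ^+ 2) * x t.
  rewrite x2 -Sr -[in S _]x2 -/(u (th t)).
  rewrite -!mulrA -expr2 g2 /x; ring.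
have v0 : v t != 0 by rewrite /v !mulf_eq0 !negb_or c0 !gt_eqF.
(* The numerator is the derivative of [v ^+ 2] read off from [energy]. *)
have -> : - 2 * f (x t ^+ 2) * x t =
   (2 * - (f (x t ^+ 2) * (x t * v t + x t * v t))) / (2 * v t) by field.
apply: is_derive_of_sqr => //.
  apply: continuousM => //; apply: continuousM; first exact: cst_continuous.
  apply: continuous_comp;
    [exact: is_derive_continuous (dth t)|exact: continuous_cos].
rewrite (_ : (fun s => _) = (fun s => 2 * (F (r ^+ 2) - F (x s ^+ 2))));
  last first.
  by apply/funext => s; exact: energy.
apply: is_deriveZ; rewrite -[X in is_derive _ _ _ X]sub0r.
apply: is_deriveB; apply: (@is_derive1_comp _ F (fun s => x s ^+ 2)).
Unshelve. all: by end_near. Qed.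

(** * The flat exponential term *)

(** This is the term [e^(-1/|x|)] in the variable [u = |x|^2], extended by 0 to a function of class
    C^1 on the whole line. *)
Definition flat_exp (R : realType) (u : R) : R :=
  if 0 < u then expR (- (1 / Num.sqrt u)) else 0.

(* The derivative of flat_exp; on u <= 0 it is 0, also at u = 0 thanks to
   0 / 0 = 0. *)
Definition flat_exp' (R : realType) (u : R) : R :=
  flat_exp u / (2 * u * Num.sqrt u).

Lemma flat_exp_ge0 (R : realType) (u : R) : 0 <= flat_exp u.
Proof. by rewrite /flat_exp; case: ifP => // _; exact: expR_ge0. Qed.

Lemma flat_exp_le (R : realType) (u v : R) : u <= v -> flat_exp u <= flat_exp v.
Proof.
move=> uv; rewrite {1}/flat_exp; case: ifPn => [u0|_]; last exact: flat_exp_ge0.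
have v0 : 0 < v := lt_le_trans u0 uv.
rewrite /flat_exp v0 ler_expR lerN2 !div1r.
by rewrite lef_pV2 ?posrE ?sqrtr_gt0// ler_wsqrtr.
Qed.

Lemma flat_exp_le_sqr (R : realType) (u : R) : flat_exp u <= 4 ^+ 4 * u ^+ 2.
Proof.
(* With s = sqrt u, the bound is (1 / (4 s)) ^ 4 <= expR (1 / (4 s)) ^ 4. *)
rewrite /flat_exp; case: ifPn => [u0|_]; last first.
  by apply: mulr_ge0; [exact: exprn_ge0|exact: sqr_ge0].
set s := Num.sqrt u; have s0 : 0 < s by rewrite sqrtr_gt0.
have us : u = s ^+ 2 by rewrite sqr_sqrtr// ltW.
have lb : (4 * s)^-1 <= expR ((4 * s)^-1).
  by have := expR_ge1Dx (4 * s)^-1; lra.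
have : (4 * s)^-1 ^+ 4 <= expR (1 / s).
  have -> : 1 / s = 4%:R * (4 * s)^-1 by field; rewrite gt_eqF.
  by rewrite expRM_natl lerXn2r// nnegrE ?expR_ge0// invr_ge0 mulr_ge0// ltW.
rewrite expRN us -exprM exprVn => H.
rewrite -[leRHS]invrK lef_pV2 ?posrE ?expR_gt0 ?invr_gt0 ?mulr_gt0 ?exprn_gt0//.
by apply: le_trans H; rewrite exprMn.
Qed.

Lemma is_derive_flat_exp (R : realType) (u : R) :
  is_derive u 1 (@flat_exp R) (flat_exp' u).
Proof.
rewrite /flat_exp'; case: (ltgtP 0 u) => [u0|u0|<-].
- have s0 : Num.sqrt u != 0 by rewrite gt_eqF// sqrtr_gt0.
  apply: (@near_eq_is_derive _ _ _ (fun z => expR (- (Num.sqrt z)^-1))).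
    near=> z; rewrite /flat_exp ifT ?div1r//; near: z; exact: lt_nbhsr.
  rewrite {1}/flat_exp u0.
  have dV := is_deriveV s0 (is_derive1_sqrt u0).
  have := is_derive1_comp (is_derive_expR _) (is_deriveN dV).
  move=> /is_derive_eq; apply; rewrite div1r -mulrA; congr (_ * _).
  rewrite -{3}[u]sqr_sqrtr ?ltW// -mulNr opprK.
  by field.
- apply: (@near_eq_is_derive _ _ _ (cst 0)).
    near=> z; rewrite /flat_exp ifF//; apply/negbTE; rewrite -leNgt ltW//.
    near: z; exact: lt_nbhsl.
  by rewrite /flat_exp ltNge (ltW u0)/= mul0r; exact: is_derive_cst.
(* At the origin the slope [flat_exp z / z] tends to 0, since the quadratic bound gives it modulus
   at most [4 ^+ 4 * |z|]. *)
- apply/is_derive1_caratheodory; exists (fun z => flat_exp z / z).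
  have E0 : flat_exp 0 = 0 :> R by rewrite /flat_exp ltxx.
  rewrite E0 !mul0r; split => //.
  + move=> z; rewrite !subr0; have [->|z0] := eqVneq z 0; first
      by rewrite E0 mulr0.
    by rewrite divfK.
  + rewrite /prop_for /continuous_at E0 mul0r.
    have c1 : (fun z : R => 4 ^+ 4 * `|z|) z @[z --> (0 : R)] --> (0 : R).
      have : {for (0 : R), continuous (fun z : R => 4 ^+ 4 * `|z|)}.
        by apply: continuousM; [exact: cst_continuous|exact: norm_continuous].
      by rewrite /prop_for /continuous_at normr0 mulr0.
    apply: (@squeeze_cvgr _ _ _ _ (fun z : R => - (4 ^+ 4 * `|z|))
      (fun z : R => 4 ^+ 4 * `|z|)) => //.
      near=> z; rewrite -ler_norml normrM normfV (ger0_norm (flat_exp_ge0 _)).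
      have [->|z0] := eqVneq z 0; first by rewrite E0 mul0r normr0 mulr0.
      rewrite ler_pdivrMr ?normr_gt0// -mulrA -expr2.
      by rewrite real_normK ?num_real// flat_exp_le_sqr.
    by have := cvgN c1; rewrite oppr0; apply.
Unshelve. all: by end_near. Qed.

Lemma flat_exp'_ge0 (R : realType) (u : R) : 0 <= u -> 0 <= flat_exp' u.
Proof.
by move=> u0; rewrite divr_ge0 ?flat_exp_ge0// !mulr_ge0 ?sqrtr_ge0.
Qed.

Lemma continuous_flat_exp' (R : realType) : continuous (@flat_exp' R).
Proof.
move=> u.
have cE : {for u, continuous (@flat_exp R)} :=
  is_derive_continuous (is_derive_flat_exp u).
have cs : {for u, continuous (@Num.sqrt R)} := @sqrt_continuous R u.
case: (ltgtP 0 u) => [u0|u0|u0].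
- apply: continuousM => //; apply: continuousV.
    by rewrite mulf_neq0 ?mulf_neq0// gt_eqF// sqrtr_gt0.
  by apply: continuousM => //; apply: continuousM;
    [exact: cst_continuous|exact: cvg_id].
- have E0 z : z < 0 -> flat_exp' z = 0 :> R.
    by move=> z0; rewrite /flat_exp' /flat_exp ltNge (ltW z0)/= mul0r.
  rewrite /continuous_at E0//.
  have : (0 : R) @[_ --> u] --> (0 : R) by exact: cvg_cst.
  apply: cvg_trans; apply: near_eq_cvg; near=> z; rewrite E0//.
  near: z; exact: lt_nbhsl.
(* At the origin the quadratic bound squeezes [flat_exp' z] between 0 and [4 ^+ 4 * Num.sqrt z]. *)
- rewrite -u0 in cs *.
  rewrite /continuous_at {2}/flat_exp' mulr0 mul0r invr0 mulr0.
  have c1 : (4 ^+ 4 * Num.sqrt z) @[z --> (0 : R)] --> (0 : R).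
    have : {for (0 : R), continuous (fun z : R => 4 ^+ 4 * Num.sqrt z)}.
      by apply: continuousM => //; exact: cst_continuous.
    by rewrite /prop_for /continuous_at sqrtr0 mulr0.
  have c2 : (0 : R) @[_ --> (0 : R)] --> (0 : R) by exact: cvg_cst.
  apply: (squeeze_cvgr _ c2 c1).
  near=> z; have [z0|z0] := leP z 0.
    by rewrite /flat_exp' /flat_exp ltNge z0/= mul0r lexx mulr_ge0 ?sqrtr_ge0.
  rewrite (flat_exp'_ge0 (ltW z0))/=.
  have s0 : 0 < Num.sqrt z by rewrite sqrtr_gt0.
  rewrite /flat_exp' ler_pdivrMr ?mulr_gt0//.
  apply: (le_trans (flat_exp_le_sqr z)).
  rewrite -[leRHS]mulrA ler_wpM2l ?exprn_ge0//.
  rewrite [leRHS](_ : _ = 2 * (z * Num.sqrt z ^+ 2)); last by ring.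
  by rewrite (sqr_sqrtr (ltW z0)) -expr2 ler_peMl ?sqr_ge0// ler1n.
Unshelve. all: by end_near. Qed.

(** * The potential as a function of the squared norm *)

Definition profile (R : realType) (k : nat) (a u : R) : R :=
  a * u ^+ k + flat_exp u.

Definition profile' (R : realType) (k : nat) (a u : R) : R :=
  a * (u ^+ k.-1 *+ k) + flat_exp' u.

Lemma is_derive_profile (R : realType) (k : nat) (a u : R) :
  is_derive u 1 (profile k a) (profile' k a u).
Proof.
apply: is_deriveD; last exact: is_derive_flat_exp.
apply: is_deriveZ.
have := @is_deriveX _ _ id k u 1 1 (is_derive_id _ _).
by rewrite fctE => /is_derive_eq; apply; rewrite [_ *: _]mulr1 mulr_natl.
Qed.

Lemma continuous_profile' (R : realType) (k : nat) (a : R) :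
  continuous (profile' k a).
Proof.
move=> u; apply: cvgD; last exact: continuous_flat_exp'.
apply: cvgM; first exact: cvg_cst.
under eq_fun do rewrite -mulr_natl; rewrite -mulr_natl.
by apply: cvgM; [exact: cvg_cst|exact: exprn_continuous].
Qed.

Lemma profile_lt (R : realType) (k : nat) (a u v : R) : (0 < k)%N -> 0 < a ->
  0 <= u -> u < v -> profile k a u < profile k a v.
Proof.
move=> k0 a0 u0 uv; rewrite ltr_leD// ?flat_exp_le ?ltW//.
by rewrite ltr_pM2l// ltrXn2r ?nnegrE -?lt0n// (le_trans u0 (ltW uv)).
Qed.

Lemma profile'_gt0 (R : realType) (k : nat) (a u : R) : (0 < k)%N -> 0 < a ->
  0 < u -> 0 < profile' k a u.
Proof.
move=> k0 a0 u0; rewrite ltr_pwDl ?flat_exp'_ge0 ?ltW//.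
by rewrite mulr_gt0// pmulrn_lgt0// exprn_gt0.
Qed.

Lemma profile_eq (R : realType) (k : nat) (a h : R) : (0 < k)%N -> 0 < a ->
  0 < h -> exists2 r, 0 < r & profile k a (r ^+ 2) = h.
Proof.
(* [U] satisfies [a * U = a + h >= h], and [U >= 1] gives [U ^+ k >= U], so the profile exceeds [h]
   at [U]. *)
move=> k0 a0 h0; pose U := 1 + h / a.
have U1 : 1 <= U by rewrite lerDl divr_ge0 ?ltW.
have p0 : profile k a 0 = 0.
  by rewrite /profile /flat_exp ltxx expr0n eqn0Ngt k0 mulr0 addr0.
have pU : h <= profile k a U.
  apply: (@le_trans _ _ (a * U)).
    by rewrite /U mulrDr mulrCA divff ?gt_eqF// !mulr1 lerDr ltW.
  rewrite /profile -[leLHS]addr0 lerD ?flat_exp_ge0// ler_pM2l//.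
  by rewrite -{1}[U]expr1 ler_weXn2l.
have [||u] := @IVT _ (profile k a) 0 U h (le_trans ler01 U1).
- apply: continuous_subspaceT => z.
  exact: is_derive_continuous (is_derive_profile _ _ _).
- by rewrite p0 ge_min le_max (ltW h0) pU orbT.
rewrite in_itv/= => /andP[u0 _] uh; exists (Num.sqrt u).
  rewrite sqrtr_gt0 lt_neqAle u0 andbT; apply: contraTneq h0 => uz.
  by rewrite -uh -uz p0 ltxx.
by rewrite sqr_sqrtr.
Qed.

(** * The gradient of the potential *)

Lemma derive_along_line (R : realType) (V W : normedModType R) (f : V -> W)
  (x v : V) : 'D_v f x = 'D_1 (fun s : R => f (s *: v + x)) 0.
Proof.
rewrite /derive; set g1 := fun _ => _; set g2 := fun _ => _.
suff -> : g1 = g2 by [].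
by apply/funext => s; rewrite /g1 /g2/= addr0 scale0r add0r [_%:A]mulr1.
Qed.

Lemma is_derive_scalel (R : realType) (V : normedModType R) (x : R -> R)
  (w : V) (t dx : R) :
  is_derive t 1 x dx -> is_derive t 1 (fun s => x s *: w) (dx *: w).
Proof.
move=> [dx1 dxE].
have H : h^-1 *: (x (h *: 1 + t) *: w - x t *: w) @[h --> 0^'] --> dx *: w.
  under eq_fun do rewrite -scalerBl scalerA.
  by apply: cvgZ; [rewrite -dxE; exact: dx1|exact: cvg_cst].
by apply: DeriveDef; [exact: cvgP H|exact: cvg_lim H].
Qed.

(** At the origin [0 < k] makes the power term vanish, which matches the value 0 prescribed
    there. *)
Lemma potential_profile (R : realType) (d k : nat) (a : R) (x : 'rV[R]_d) :
  (0 < k)%N -> potential k a x = profile k a (\sum_(i < d) x 0 i ^+ 2).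
Proof.
move=> k0; rewrite /potential /profile /enorm /flat_exp.
have N0 : 0 <= \sum_(i < d) x 0 i ^+ 2
  by apply: sumr_ge0 => i _; exact: sqr_ge0.
have [->|x0] := eqVneq x 0.
  rewrite big1 => [|i _]; last by rewrite mxE expr0n.
  by rewrite ltxx expr0n eqn0Ngt k0 mulr0 addr0.
rewrite exprM sqr_sqrtr// ifT// lt_neqAle N0 andbT eq_sym.
rewrite psumr_neq0; last by move=> i _; exact: sqr_ge0.
have /rV0Pn[i xi] := x0; apply/hasP; exists i; first by rewrite mem_index_enum.
by rewrite /= exprn_even_gt0.
Qed.

(** Along the [i]-th coordinate line the squared norm is [N + 2 * x 0 i * s + s ^+ 2], so each
    partial derivative is a one-variable chain rule, valid at the origin too. *)
Lemma gradient_potential (R : realType) (d k : nat) (a : R) (x : 'rV[R]_d) :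
  (0 < k)%N ->
  gradient (potential k a) x =
    (2 * profile' k a (\sum_(i < d) x 0 i ^+ 2)) *: x.
Proof.
move=> k0; apply/rowP => i; rewrite !mxE derive_along_line.
set N := \sum_(i < d) x 0 i ^+ 2.
have -> : (fun s : R => potential k a (s *: delta_mx 0 i + x)) =
    (fun s => profile k a (N + (2 * x 0 i * s + s ^+ 2))).
  apply/funext => s; rewrite potential_profile//; congr profile.
  rewrite /N (bigD1 i)//= [in RHS](bigD1 i)//= !mxE !eqxx/= mulr1.
  rewrite (eq_bigr (fun j => x 0 j ^+ 2)) => [|j /negbTE ji]; last first.
    by rewrite !mxE ji andbF mulr0 add0r.
  ring.
pose G (s : R) := N + (2 * x 0 i * s + s ^+ 2).
have dG : is_derive (0 : R) 1 G (2 * x 0 i).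
  have d2 : is_derive (0 : R) 1 (fun s : R => s ^+ 2) 0.
    have := @is_deriveX _ _ id 2 (0 : R) 1 1 (is_derive_id _ _).
    by rewrite fctE => /is_derive_eq; apply; rewrite expr1 mulr0 scale0r.
  have d1 : is_derive (0 : R) 1 (fun s : R => 2 * x 0 i * s) (2 * x 0 i).
    have := is_deriveZ (2 * x 0 i) (is_derive_id (0 : R) 1).
    by move=> /is_derive_eq; apply; rewrite [_ *: _]mulr1.
  have := is_deriveD (is_derive_cst N (0 : R) 1) (is_deriveD d1 d2).
  by move=> /is_derive_eq; apply; rewrite add0r addr0.
have G0 : G 0 = N by rewrite /G mulr0 expr0n/= !addr0.
have dP := is_derive_profile k a (G 0).
have [_ ->] := is_derive1_comp dP dG.
by rewrite G0; ring.
Qed.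

(** * From the scalar oscillation to a rectilinear solution *)

Theorem corollary1p6 (R : realType) (d k : nat) (hd : (1 <= d)%N)
    (hk : (1 <= k)%N) (a : R) (ha : 0 < a) (h : R) (hh : 1 < h) :
  exists (T : R) (q : R -> 'rV[R]_d),
    [/\ 0 < T, C2 q, periodic q T & exists s t : R, q s != q t] /\
    (forall t : R,
       derive1n 2 q t + gradient (potential k a) (q t) = 0 /\
       1 / 2 * enorm (derive1 q t) ^+ 2 + potential k a (q t) = h).
Proof.
have [r r0 rh] := profile_eq hk ha (lt_trans ltr01 hh).
have [|u u0 ur|x [v [T [[T0 xT [s1 [s2 [xs1 xs2]]]] xv]]]] :=
  oscillation (is_derive_profile k a) r0.
- by rewrite profile'_gt0// exprn_gt0.
- exact: profile_lt.
(* The motion takes place along the first basis vector, which exists since [1 <= d]. *)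
pose i0 := Ordinal hd; pose w : 'rV[R]_d := delta_mx 0 i0.
have wN y : \sum_(i < d) (y *: w) 0 i ^+ 2 = y ^+ 2.
  rewrite (bigD1 i0)//= big1 => [|i /negbTE ii0]; rewrite !mxE ?eqxx.
    by rewrite mulr1 addr0.
  by rewrite ii0 andbF mulr0 expr0n.
pose acc t := - 2 * profile' k a (x t ^+ 2) * x t.
have dq (t : R) : is_derive t 1 (fun t => x t *: w) (v t *: w).
  by apply: is_derive_scalel; case: (xv t).
have dv (t : R) : is_derive t 1 (fun t => v t *: w) (acc t *: w).
  by apply: is_derive_scalel; case: (xv t).
have q1 : (fun t => x t *: w)^`() = (fun t => v t *: w).
  by apply/funext => z; rewrite derive1E; case: (dq z).
have q2 : (fun t => x t *: w)^`(2) = (fun t => acc t *: w).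
  rewrite derive1nS derive1n1 q1; apply/funext => z.
  by rewrite derive1E; case: (dv z).
have cx : continuous x
  by move=> z; have [dx _ _] := xv z; exact: is_derive_continuous dx.
exists T, (fun t => x t *: w); split.
  split => //.
  - split; [by move=> z; case: (dq z)|by move=> z; rewrite q1; case: (dv z)|].
    rewrite q2 => z; apply: cvgZ; last exact: cvg_cst.
    apply: cvgM; last exact: cx.
    apply: cvgM; first exact: cvg_cst.
    apply: (@continuous_comp _ _ _ (fun z => x z ^+ 2) (profile' k a));
      last exact: continuous_profile'.
    by apply: (@continuous_comp _ _ _ x (fun y : R => y ^+ 2));
      [exact: cx|exact: exprn_continuous].
  - by move=> z; rewrite xT.
  - exists s1, s2; rewrite xs1 xs2 scale0r eq_sym scaler_eq0 gt_eqF//=.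
    by apply/rV0Pn; exists i0; rewrite mxE !eqxx oner_eq0.
move=> z; rewrite q2 q1 gradient_potential// potential_profile// wN; split.
  by rewrite scalerA -scalerDl /acc mulNr mulNr addNr scale0r.
by rewrite /enorm wN sqr_sqrtr ?sqr_ge0// -rh; case: (xv z).
Qed.
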